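(* Let $k$ be a field of characteristic $0$ and let $u\in B$ be a basis monomial of $\mathrm{DerPerm}\langle X\rangle$ with $\mathrm{wt}(u)=-2$. Then $u'\in\overline{ST}\langle X\rangle$. In particular, $\overline{S}\subseteq\overline{ST}\langle X\rangle$, where $$\overline{S}:=X\cup\{u'\mid u\in B,\ \mathrm{wt}(u)=-2\}.$$
   Context: A perm algebra is an associative algebra satisfying $(ab)c=(ba)c$. $\mathrm{DerPerm}\langle X\rangle$ is the free differential perm algebra on $X=\{x_1,x_2,\dots\}$ over $k$: the free perm algebra generated by the symbols $x^{(s)}$ ($x\in X$, $s\ge0$, $x^{(0)}=x$) with derivation $d$ (written $a'=d(a)$) determined by $d(x^{(s)})=x^{(s+1)}$ and the Leibniz rule. $B$ is its standard basis, consisting of the monomials $x_{k_1}^{(i_1)}\cdots x_{k_{n-1}}^{(i_{n-1})}x_{k_n}^{(i_n)}$ with $n\ge1$, $k_1\le\dots\le k_{n-1}$, $k_n$ arbitrary, $i_j\ge 0$ (the first $n-1$ factors commute; monomials are identified when equal as elements). The weight of such a monomial is $\mathrm{wt}=\sum_{j=1}^n(i_j-1)$. $\overline{ST}\langle X\rangle$ is the smallest linear subspace of $\mathrm{DerPerm}\langle X\rangle$ containing $X$ and closed under the product $a\bullet b:=a'b+ab'$. *)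

(* Defs.v *)
From HB Require Import structures.
From mathcomp Require Import all_boot all_order all_algebra.
From mathcomp Require Import finmap multiset monalg zify.

Set Implicit Arguments.
Unset Strict Implicit.
Unset Printing Implicit Defensive.

Import GRing.Theory.
Local Open Scope mset_scope.
Local Open Scope ring_scope.

Section LinearExtension.
Variables (k : fieldType) (K : choiceType) (A : lmodType k).
Implicit Types (f g : K -> A) (a b : {malg k[K]}).

Definition linext f a : A := \sum_(m <- msupp a) a@_m *: f m.

Lemma linextEw f (D : {fset K}) a : (msupp a `<=` D)%fset ->
  linext f a = \sum_(m <- D) a@_m *: f m.
Proof.
move=> sD; rewrite /linext; apply: (@big_fset_incl _ _ _ _ _ _ _) => // m _ hm.
by rewrite mcoeff_outdom // scale0r.
Qed.

Lemma linext_linear f : linear (linext f).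
Proof.
move=> z a b; pose D := (msupp (z *: a + b) `|` (msupp a `|` msupp b))%fset.
have h0 : (msupp (z *: a + b) `<=` D)%fset by rewrite fsubsetUl.
have h1 : (msupp a `<=` D)%fset.
  by apply: fsubset_trans (fsubsetUr _ _); rewrite fsubsetUl.
have h2 : (msupp b `<=` D)%fset.
  by apply: fsubset_trans (fsubsetUr _ _); rewrite fsubsetUr.
rewrite (linextEw f h0) (linextEw f h1) (linextEw f h2) scaler_sumr -big_split.
by apply: eq_bigr => m _; rewrite mcoeffD mcoeffZ scalerDl scalerA.
Qed.

HB.instance Definition _ f := GRing.isLinear.Build k {malg k[K]} A _
  (linext f) (linext_linear f).

Lemma linextU f m : linext f << m >> = f m.
Proof. by rewrite /linext msuppU oner_eq0 big_seq_fset1 mcoeffUU scale1r. Qed.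

Lemma malg_basisE a : a = \sum_(m <- msupp a) a@_m *: << m >>.
Proof.
rewrite {1}[a]monalgE; apply: eq_bigr => m _.
by apply/malgP => n; rewrite mcoeffZ !mcoeffU; case: eqP; rewrite ?mulr1 ?mulr0.
Qed.

Lemma linextDf f g a : linext (fun m => f m + g m) a = linext f a + linext g a.
Proof. by rewrite /linext -big_split; apply: eq_bigr => m _; rewrite scalerDr. Qed.

Lemma linextZf z f a : linext (fun m => z *: f m) a = z *: linext f a.
Proof.
by rewrite /linext scaler_sumr; apply: eq_bigr => m _; rewrite !scalerA mulrC.
Qed.

End LinearExtension.

(* (j, s) stands for the symbol x_j^(s); X is indexed by nat, from 0. *)
Definition dvar := (nat * nat)%type.
HB.instance Definition _ := Choice.on dvar.

(* In a perm algebra all the factors of a product but the last one commute;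
   the pair (M, y) encodes the basis monomial whose first factors form the
   multiset M and whose last factor is y, so that two words are equal as
   elements iff they have the same code. *)
Definition pmon := ({mset dvar} * dvar)%type.
HB.instance Definition _ := Choice.on pmon.

Definition pmon_mul (m n : pmon) : pmon := (m.1 `+` (m.2 +` n.1), n.2).

Definition succ_dvar (x : dvar) : dvar := (x.1, x.2.+1).

Definition wt (m : pmon) : int :=
  \sum_(x <- m.1) (x.2%:Z - 1) + (m.2.2%:Z - 1).

Definition DerPerm (k : fieldType) := {malg k[pmon]}.
HB.instance Definition _ (k : fieldType) := GRing.Lmodule.on (DerPerm k).

(* bmon, pmul and der are locked only to keep unification from computing with
   finitely supported functions. *)
HB.lock Definition bmon (k : fieldType) (m : pmon) : DerPerm k := << m >>.

Definition gen (k : fieldType) (x : dvar) : DerPerm k := bmon k (mset0, x).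

(* MathComp has no structure for non-unital algebras. *)
HB.lock Definition pmul (k : fieldType) (a b : DerPerm k) : DerPerm k :=
  linext (fun m => linext (fun n => bmon k (pmon_mul m n)) b) a.

(* The sum ranges over the multiset m.1, with multiplicities. *)
Definition der_bmon (k : fieldType) (m : pmon) : DerPerm k :=
  \sum_(x <- m.1) bmon k (succ_dvar x +` (m.1 `\ x), m.2)
  + bmon k (m.1, succ_dvar m.2).

HB.lock Definition der (k : fieldType) (a : DerPerm k) : DerPerm k :=
  linext (@der_bmon k) a.

Section Closure.
Variable k : fieldType.
Implicit Types a b : DerPerm k.

Definition bullet a b : DerPerm k := pmul (der a) b + pmul a (der b).

Inductive STbar : DerPerm k -> Prop :=
| STbar_gen (j : nat) : STbar (gen k (j, 0%N))
| STbar_zero : STbar 0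
| STbar_add a b : STbar a -> STbar b -> STbar (a + b)
| STbar_scale (z : k) a : STbar a -> STbar (z *: a)
| STbar_bullet a b : STbar a -> STbar b -> STbar (bullet a b).

Definition Sbar (v : DerPerm k) : Prop :=
  (exists j : nat, v = gen k (j, 0%N))
  \/ (exists m : pmon, wt m = -2 /\ v = der (bmon k m)).

End Closure.

(* The rest of the file checks that the data above is the free perm algebra on
   the symbols x_j^(s) (DerPerm_perm, DerPerm_free) with the derivation
   determined by x_j^(s) |-> x_j^(s+1) (der_gen, der_leibniz, der_uniq) and its
   standard basis (bmon_word, bmon_std). *)

Record perm_algebra (k : fieldType) (A : lmodType k) (mul : A -> A -> A) :
    Prop := PermAlgebra {
  perm_linl : forall b, linear (mul^~ b);
  perm_linr : forall a, linear (mul a);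
  perm_mulA : forall a b c, mul a (mul b c) = mul (mul a b) c;
  perm_mulC : forall a b c, mul (mul a b) c = mul (mul b a) c
}.

Section Theory.
Variable k : fieldType.
Local Notation DP := (DerPerm k).
Implicit Types (a b c : DP) (m n : pmon).

Lemma linext_bmon (A : lmodType k) (f : pmon -> A) m :
  linext f (bmon k m) = f m.
Proof. by rewrite bmon.unlock linextU. Qed.

Lemma pmul_linl b : linear (fun a => pmul a b).
Proof. by rewrite pmul.unlock; exact: linext_linear. Qed.

Lemma pmul_linr a : linear (pmul a).
Proof.
move=> z b c; rewrite pmul.unlock -linextZf -linextDf /linext.
by apply: eq_bigr => m _; congr (_ *: _); exact: linext_linear.
Qed.

HB.instance Definition _ a := GRing.isLinear.Build k DP DP _
  (pmul a) (pmul_linr a).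

Lemma pmulU m n : pmul (bmon k m) (bmon k n) = bmon k (pmon_mul m n).
Proof. by rewrite pmul.unlock !linext_bmon. Qed.

Lemma der_linear : linear (@der k).
Proof. by rewrite der.unlock; exact: linext_linear. Qed.

HB.instance Definition _ := GRing.isLinear.Build k DP DP _
  (@der k) der_linear.

Lemma derU m : der (bmon k m) = der_bmon k m.
Proof. by rewrite der.unlock linext_bmon. Qed.

Lemma pmulPl z a b c : pmul (z *: a + b) c = z *: pmul a c + pmul b c.
Proof. exact: pmul_linl. Qed.

Lemma pmulPr z a b c : pmul a (z *: b + c) = z *: pmul a b + pmul a c.
Proof. exact: pmul_linr. Qed.

Lemma pmul0l b : pmul 0 b = 0.
Proof. by rewrite pmul.unlock linear0. Qed.

Lemma pmul0r b : pmul b 0 = 0.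
Proof. exact: linear0. Qed.

Lemma derP z a b : der (z *: a + b) = z *: der a + der b.
Proof. exact: der_linear. Qed.

Lemma der0 : der (0 : DP) = 0.
Proof. exact: linear0. Qed.

Lemma DerPerm_ind (P : DP -> Prop) :
  (forall m, P (bmon k m)) -> P 0 ->
  (forall (z : k) a b, P a -> P b -> P (z *: a + b)) -> forall a, P a.
Proof.
move=> PU P0 PL a; rewrite [a]malg_basisE; elim/big_rec: _ => // m b _ Pb.
by apply: PL => //; have := PU m; rewrite bmon.unlock.
Qed.

Lemma pmon_mulA : associative pmon_mul.
Proof.
move=> m n p; congr pair; apply/msetP => x; rewrite !msetE2 /=.
by rewrite !addnA.
Qed.

Lemma pmon_mulC m n p :
  pmon_mul (pmon_mul m n) p = pmon_mul (pmon_mul n m) p.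
Proof.
congr pair; apply/msetP => x; rewrite !msetE2 /=; lia.
Qed.

Lemma DerPerm_perm : perm_algebra (@pmul k).
Proof.
split; [exact: pmul_linl | exact: pmul_linr | | ].
- move=> a b c; elim/DerPerm_ind: a => [m||z a1 a2 h1 h2].
  + elim/DerPerm_ind: b => [n||z b1 b2 h1 h2].
    * elim/DerPerm_ind: c => [p||z c1 c2 h1 h2].
      - by rewrite !pmulU pmon_mulA.
      - by rewrite !(pmul0l, pmul0r).
      - by rewrite !(pmulPl, pmulPr) h1 h2.
    * by rewrite !(pmul0l, pmul0r).
    * by rewrite !(pmulPl, pmulPr) h1 h2.
  + by rewrite !(pmul0l, pmul0r).
  + by rewrite !(pmulPl, pmulPr) h1 h2.
- move=> a b c; elim/DerPerm_ind: a => [m||z a1 a2 h1 h2].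
  + elim/DerPerm_ind: b => [n||z b1 b2 h1 h2].
    * elim/DerPerm_ind: c => [p||z c1 c2 h1 h2].
      - by rewrite !pmulU pmon_mulC.
      - by rewrite !(pmul0l, pmul0r).
      - by rewrite !(pmulPl, pmulPr) h1 h2.
    * by rewrite !(pmul0l, pmul0r).
    * by rewrite !(pmulPl, pmulPr) h1 h2.
  + by rewrite !(pmul0l, pmul0r).
  + by rewrite !(pmulPl, pmulPr) h1 h2.
Qed.

Lemma perm_msetD (M N : {mset dvar}) : perm_eq (M `+` N) (M ++ N).
Proof.
by apply/allP => x _ /=; rewrite count_cat !count_mem_mset msetE2.
Qed.

Lemma perm_mset1 (x : dvar) : perm_eq [mset x] [:: x].
Proof. by rewrite enum_msetn. Qed.

Lemma der_gen (x : dvar) : der (gen k x) = gen k (succ_dvar x).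
Proof. by rewrite derU /der_bmon big_mset0 add0r. Qed.

Lemma der_leibniz a b : der (pmul a b) = pmul (der a) b + pmul a (der b).
Proof.
have L1 (p q r t : nat) : (t <= q -> p + (q + r - t) = p + (q - t) + r)%N.
  by lia.
have L3 (p q r s t : nat) :
    (t <= s -> p + (q + (r + s) - t) = q + (r + (p + (s - t))))%N.
  by lia.
have PDl c d e : pmul (c + d) e = pmul c e + pmul d e.
  by rewrite -[c]scale1r pmulPl !scale1r.
elim/DerPerm_ind: a => [m||z a1 a2 h1 h2].
- elim/DerPerm_ind: b => [n||z b1 b2 h1 h2].
  + have Psum (s : seq dvar) (F : dvar -> DP) c :
        pmul (\sum_(x <- s) F x) c = \sum_(x <- s) pmul (F x) c.
      by elim/big_rec2: _ => [|x u v _ <-]; rewrite ?pmul0l ?PDl.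
    rewrite pmulU !derU /der_bmon PDl linearD linear_sum Psum !pmulU.
    rewrite (perm_big _ (perm_msetD _ _)) big_cat /=.
    rewrite (perm_big _ (perm_msetD _ _)) big_cat /=.
    rewrite (perm_big _ (perm_mset1 _)) big_seq1 /= -!addrA.
    congr (_ + _); [|congr (_ + _); [|congr (_ + _)]] => //.
    * rewrite big_seq [RHS]big_seq; apply: eq_bigr => x hx; rewrite pmulU.
      congr (bmon _ _); congr pair; apply/msetP => y; rewrite !msetE2 /=.
      have hxy : ([mset x] y <= m.1 y)%N.
        by rewrite msetnE; case: eqP => [->|_] //; rewrite mset_gt0.
      exact: L1.
    * congr (bmon _ _); congr pair; apply/msetP => y; rewrite !msetE2 /=; lia.
    * rewrite big_seq [RHS]big_seq; apply: eq_bigr => x hx; rewrite pmulU.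
      congr (bmon _ _); congr pair; apply/msetP => y; rewrite !msetE2 /=.
      have hxy : ([mset x] y <= n.1 y)%N.
        by rewrite msetnE; case: eqP => [->|_] //; rewrite mset_gt0.
      exact: L3.
    * by rewrite pmulU.
  + by rewrite !(pmul0l, pmul0r, der0) addr0.
  + by rewrite !(pmulPl, pmulPr, derP) h1 h2 scalerDr addrACA.
- by rewrite !(pmul0l, pmul0r, der0) addr0.
- by rewrite !(pmulPl, pmulPr, derP) h1 h2 scalerDr addrACA.
Qed.

Lemma bmon_word (s : seq dvar) (y : dvar) :
  foldr (fun x => pmul (gen k x)) (gen k y) s = bmon k (seq_mset s, y).
Proof.
elim: s => [|x s IH] /=.
  by congr (bmon _ _); congr pair; apply/msetP => z; rewrite mset_seqE mset0E.
rewrite IH pmulU; congr (bmon _ _); congr pair; apply/msetP => z /=.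
by rewrite msetE2 mset0E add0n mset1DE !mset_seqE /= eq_sym.
Qed.

Lemma bmon_std m : exists s : seq dvar,
  [/\ sorted (fun x y : dvar => (x.1 <= y.1)%N) s,
      bmon k m = foldr (fun x => pmul (gen k x)) (gen k m.2) s &
      wt m = \sum_(x <- rcons s m.2) (x.2%:Z - 1)].
Proof.
pose r := fun x y : dvar => (x.1 <= y.1)%N.
exists (sort r m.1); split.
- by apply: sort_sorted => x y; exact: leq_total.
- rewrite bmon_word; congr (bmon _ _); rewrite [LHS]surjective_pairing.
  by congr pair; rewrite -[LHS]seq_mset_id; apply/eq_seq_msetP; rewrite perm_sym perm_sort.
- rewrite -cats1 big_cat big_seq1 /wt; congr (_ + _); apply: perm_big.
  by rewrite perm_sym perm_sort.
Qed.

Lemma der_uniq (D : {linear DP -> DP}) :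
  (forall a b, D (pmul a b) = pmul (D a) b + pmul a (D b)) ->
  (forall x, D (gen k x) = gen k (succ_dvar x)) -> D =1 @der k.
Proof.
move=> DM Dg a; elim/DerPerm_ind: a => [m||z a b ha hb].
- have [s [_ -> _]] := bmon_std m; elim: s => [|x s IH] /=.
    by rewrite Dg der_gen.
  by rewrite DM der_leibniz IH Dg der_gen.
- by rewrite der0; exact: linear0.
- by rewrite derP -ha -hb; exact: linearP.
Qed.

Lemma DerPerm_free (A : lmodType k) (mul : A -> A -> A) (f : dvar -> A) :
  perm_algebra mul ->
  exists phi : {linear DP -> A},
    [/\ forall a b, phi (pmul a b) = mul (phi a) (phi b),
        forall x, phi (gen k x) = f x &
        forall psi : {linear DP -> A},
          (forall a b, psi (pmul a b) = mul (psi a) (psi b)) ->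
          (forall x, psi (gen k x) = f x) -> psi =1 phi].
Proof.
case=> ll lr mA mC.
have m0l (b : A) : mul 0 b = 0.
  by have /= := ll b (-1) 0 0; rewrite scaler0 addr0 scaleN1r addNr.
have m0r (a : A) : mul a 0 = 0.
  by have /= := lr a (-1) 0 0; rewrite scaler0 addr0 scaleN1r addNr.
pose w (s : seq dvar) (e : A) := foldr (fun x => mul (f x)) e s.
pose F (m : pmon) := w m.1 (f m.2).
have wperm e (s t : seq dvar) : perm_eq s t -> w s e = w t e.
  move: s t; apply: catCA_perm_subst => s1 s2 s3.
  rewrite /w !foldr_cat; move: (foldr _ e s3) => {}e.
  have cx x u e0 : mul (f x) (w u e0) = w u (mul (f x) e0).
    by elim: u => //= y u IH; rewrite mA mC -mA IH.
  by rewrite -!/(w _ _); elim: s1 => //= x s1 ->; rewrite cx.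
have wmul s e (b : A) : mul (w s e) b = w s (mul e b).
  by elim: s => //= x s IH; rewrite -mA IH.
have FM m n : F (pmon_mul m n) = mul (F m) (F n).
  rewrite /F wmul (wperm _ _ (m.1 ++ m.2 :: n.1)) /w ?foldr_cat //.
  rewrite (perm_trans (perm_msetD _ _)) // perm_cat2l.
  rewrite (perm_trans (perm_msetD _ _)) // -cat1s perm_cat2r.
  exact: perm_mset1.
have [phi phiU] : exists phi : {linear DP -> A}, forall m, phi (bmon k m) = F m.
  by exists (linext F : {linear {malg k[pmon]} -> A}) => m;
    exact: linext_bmon.
have phiP z a b : phi (z *: a + b) = z *: phi a + phi b by exact: linearP.
have phi0 : phi 0 = 0 by exact: linear0.
exists phi; split.
- move=> a b; elim/DerPerm_ind: a => [m||z a1 a2 h1 h2].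
  + elim/DerPerm_ind: b => [n||z b1 b2 h1 h2].
    * by rewrite pmulU !phiU FM.
    * by rewrite pmul0r phi0 m0r.
    * by rewrite pmulPr !phiP h1 h2 lr.
  + by rewrite pmul0l phi0 m0l.
  + by rewrite pmulPl !phiP h1 h2 [RHS]ll.
- by move=> x; rewrite phiU /F /w enum_mset0.
- move=> psi psiM psig a; elim/DerPerm_ind: a => [m||z a b ha hb].
  + rewrite phiU; have -> : bmon k m = bmon k (seq_mset m.1, m.2).
      by rewrite seq_mset_id -surjective_pairing.
    rewrite -bmon_word /F /w; elim: (EnumMset.f m.1) => [|x s IH] /=.
      exact: psig.
    by rewrite psiM psig IH.
  + by rewrite phi0; exact: linear0.
  + by rewrite phiP -ha -hb; exact: linearP.
Qed.

End Theory.

(* Main.v *)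
Require Import Defs.
From mathcomp Require Import all_boot all_order all_algebra.
From mathcomp Require Import finmap multiset zify.
Import GRing.Theory.
Local Open Scope ring_scope.

(* Let W be the space of elements of weight -2 whose derivative lies in STbar;
   it contains the product of any two elements of STbar.  Fix n variables, one
   of them last; the monomials of weight -2 in them are given by the exponent
   functions m of degree n - 2, and by induction on n we may assume that W
   contains every monomial of weight -2 in fewer variables.  Write d_i for the
   i-th unit exponent.  Multiplying x_i by the derivative of a monomial in the
   other variables gives, modulo W,
     sum_(j <> i) (m + d_j) = 0                             if m i = 0,
   and multiplying (x_i x_l)' by such a derivative gives
     sum_(j <> i, l) ((m + d_i + d_j) + (m + d_l + d_j)) = 0
                                                    if m i = m l = 0.
   The marked last factor plays no role: a product can be taken in either
   order, so as to put the marked factor last.  The first relation shows by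
   induction on a that m + a d_i = m + a d_j modulo W when m i = m j = 0; with
   the second one, it kills the monomials with an exponent 2, then those with
   a larger exponent, and finally those with all exponents at most 1. *)

Set Implicit Arguments.
Unset Strict Implicit.

(** * Exponent functions on a finite set *)

Section Exponents.
Variable I : finType.
Implicit Types (e m : {ffun I -> nat}) (i j l : I) (a : nat).

Definition raise m i a : {ffun I -> nat} := [ffun x => (m x + (x == i) * a)%N].

Definition deg e : nat := (\sum_i e i)%N.

Lemma deg_raise m i a : deg (raise m i a) = (deg m + a)%N.
Proof.
rewrite /deg; under eq_bigr do rewrite ffunE.
rewrite big_split /=; congr addn.
by rewrite (bigD1 i) //= eqxx mul1n big1 ?addn0 // => x /negbTE ->.
Qed.

Lemma raise_ne m i a x : x != i -> raise m i a x = m x.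
Proof. by move=> /negbTE nx; rewrite ffunE nx mul0n addn0. Qed.

Lemma raise_eq m i a : raise m i a i = (m i + a)%N.
Proof. by rewrite ffunE eqxx mul1n. Qed.

Lemma raise0 m i : raise m i 0 = m.
Proof. by apply/ffunP => x; rewrite ffunE muln0 addn0. Qed.

Lemma raiseC m i j a b : raise (raise m i a) j b = raise (raise m j b) i a.
Proof. by apply/ffunP => x; rewrite !ffunE addnAC. Qed.

Lemma raiseD m i a b : raise (raise m i a) i b = raise m i (a + b).
Proof. by apply/ffunP => x; rewrite !ffunE -addnA mulnDr. Qed.

Lemma raise_pred e i : (0 < e i)%N ->
  exists2 m : {ffun I -> nat}, m i = (e i).-1 & e = raise m i 1.
Proof.
move=> e_gt0; exists [ffun x => (e x - (x == i))%N].
  by rewrite ffunE eqxx subn1.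
apply/ffunP => x; rewrite !ffunE muln1.
by case: eqP => [->|_] /=; lia.
Qed.

(** Otherwise the exponents away from [i] are all positive and already sum to at least
    [#|I| - 1]. *)
Lemma exists_zero e i : (deg e + 1 < #|I|)%N -> exists2 l, l != i & e l = 0%N.
Proof.
move=> lt_e; have [/existsP[l /andP[nl /eqP el]]|no0] :=
  boolP [exists l, (l != i) && (e l == 0%N)]; first by exists l.
move: lt_e; rewrite ltnNge => /negP[].
have : (\sum_(j in predC1 i) 1 <= \sum_(j | j != i) e j)%N.
  apply: leq_sum => j nj; rewrite lt0n; apply/negP => ej.
  by move/negP: no0; apply; apply/existsP; exists j; apply/andP.
rewrite sum1_card cardC1 /deg [X in _ -> (_ <= X + 1)%N](bigD1 i) //=; lia.
Qed.

End Exponents.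

(** * Linear consequences of the two relations modulo [W] *)

Section Reduction.
Variables (k : fieldType) (A : lmodType k) (W : A -> Prop).
Hypothesis char0 : [pchar k] =i pred0.
Hypothesis W0 : W 0.
Hypothesis WD : forall a b, W a -> W b -> W (a + b).
Hypothesis WZ : forall (z : k) a, W a -> W (z *: a).
Variables (I : finType) (F : {ffun I -> nat} -> A).
Implicit Types (e m : {ffun I -> nat}) (i j l : I).

Hypothesis F_split1 : forall e i, e i = 0%N -> (deg e + 3 = #|I|)%N ->
  W (\sum_(j | j != i) F (raise e j 1)).
Hypothesis F_split2 : forall e i l, i != l -> e i = 0%N -> e l = 0%N ->
  (deg e + 4 = #|I|)%N ->
  W (\sum_(j | (j != i) && (j != l))
       (F (raise (raise e i 1) j 1) + F (raise (raise e l 1) j 1))).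

Lemma WN a : W a -> W (- a).
Proof. by rewrite -scaleN1r; exact: WZ. Qed.

Lemma WB a b : W a -> W b -> W (a - b).
Proof. by move=> Wa /WN; exact: WD. Qed.

Lemma WDr a b : W b -> W (a + b) -> W a.
Proof. by move=> Wb Wab; rewrite -[a](addrK b); exact: WB. Qed.

Lemma W_sum (J : Type) (r : seq J) (P : pred J) (G : J -> A) :
  (forall x, P x -> W (G x)) -> W (\sum_(x <- r | P x) G x).
Proof. by move=> WG; elim/big_ind: _. Qed.

(** Characteristic 0 enters here: [n.+1] is invertible in [k]. *)
Lemma W_natmul a n : W (a *+ n.+1) -> W a.
Proof.
move=> Wa; rewrite -[a]scale1r -(@mulVf _ n.+1%:R); last first.
  by move/pcharf0P: char0 => ->.
by rewrite -scalerA scaler_nat; exact: WZ.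
Qed.

(** Induction on [a]: subtract the first relation at [i] for [m + a d_j] from the one at [j] for
    [m + a d_i]. The terms raised at a third index [x] cancel modulo [W] by induction applied to
    [m + d_x]. *)
Lemma exchange m i j a : m i = 0%N -> m j = 0%N -> i != j ->
  (deg m + a + 2 = #|I|)%N -> W (F (raise m i a) - F (raise m j a)).
Proof.
elim: a m => [|a IH] m mi mj nij dm; first by rewrite !raise0 subrr.
have nji : j != i by rewrite eq_sym.
have := @F_split1 (raise m i a) j; rewrite raise_ne // deg_raise.
move=> /(_ mj ltac:(lia)); rewrite (bigD1 i) //= raiseD addn1 => Wi.
have := @F_split1 (raise m j a) i; rewrite raise_ne // deg_raise.
move=> /(_ mi ltac:(lia)); rewrite (bigD1 j) //= raiseD addn1 => Wj.
have Ws : W (\sum_(x | (x != j) && (x != i))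
    (F (raise (raise m i a) x 1) - F (raise (raise m j a) x 1))).
  apply: W_sum => x /andP[xj xi]; rewrite 2!(raiseC _ _ x).
  by apply: IH; rewrite ?raise_ne 1?eq_sym ?deg_raise //; lia.
apply: WDr Ws _; rewrite sumrB addrACA -opprD.
by under [X in _ - (_ + X)]eq_bigl do rewrite andbC; exact: WB.
Qed.

Lemma reduce_two m i : m i = 0%N -> (deg m + 4 = #|I|)%N -> W (F (raise m i 2)).
Proof.
move=> mi dm; have [|l nl ml] := @exists_zero I m i; first lia.
(* By [exchange], the two halves of the second relation agree modulo [W], so twice this sum lies in
   [W]. *)
have Ws : W (\sum_(j | (j != i) && (j != l)) F (raise (raise m i 1) j 1)).
  apply: (@W_natmul _ 1); rewrite mulr2n.
  have Wd : W (\sum_(j | (j != i) && (j != l))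
      (F (raise (raise m i 1) j 1) - F (raise (raise m l 1) j 1))).
    apply: W_sum => x /andP[xi xl]; rewrite 2!(raiseC _ _ x).
    by apply: exchange; rewrite ?raise_ne 1?eq_sym ?deg_raise //; lia.
  have := WD Wd (F_split2 (i := i) (l := l) _ mi ml dm).
  rewrite -big_split -[X in _ -> W X]big_split /= eq_sym => /(_ nl).
  by under eq_bigr do rewrite addrACA addNr addr0.
(* The first relation at [l] for [m + d_i] is the sum in [Ws] plus the term of [m + 2 d_i]. *)
apply: WDr Ws _; have := @F_split1 (raise m i 1) l.
rewrite raise_ne // deg_raise => /(_ ml ltac:(lia)).
rewrite (bigD1 i) 1?eq_sym //= raiseD.
by under eq_bigl do rewrite andbC.
Qed.

(** Induction on [e i], starting from [reduce_two]. With [e = m + d_i] and [m l = 0], the first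
    relation at [l] for [m] expresses [F e] through terms whose exponent at [i] is [e i - 1]. *)
Lemma reduce_ge2 e i : (1 < e i)%N -> (deg e + 2 = #|I|)%N -> W (F e).
Proof.
move: {2}(e i) (erefl (e i)) => c.
elim: c e => [|c IH] e ei; rewrite ei // => c_gt0 de.
have [|m mi em] := @raise_pred I e i; first by rewrite ei.
rewrite ei /= in mi; have dm : (deg m + 3 = #|I|)%N.
  by move: de; rewrite em deg_raise; lia.
move: c_gt0; rewrite ltnS leq_eqVlt => /predU1P[c1|c_gt1].
  have [|m' m'i mm] := @raise_pred I m i; first by rewrite mi -c1.
  rewrite em mm raiseD; apply: reduce_two; first by rewrite m'i mi -c1.
  by move: dm; rewrite mm deg_raise; lia.
have [|l nl ml] := @exists_zero I m i; first lia.
have := F_split1 ml dm; rewrite (bigD1 i) 1?eq_sym //= -em.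
apply: WDr; apply: W_sum => x /andP[_ xi].
by apply: IH; rewrite ?raise_ne ?deg_raise 1?eq_sym ?mi //; lia.
Qed.

Lemma W_reduced e : (2 < #|I|)%N -> (deg e + 2 = #|I|)%N -> W (F e).
Proof.
move=> I_gt2 de; have [i e_gt0] : exists i, (0 < e i)%N.
  apply/existsP; rewrite -[X in is_true X]negbK negb_exists.
  apply/negP => /forallP e0; move: de I_gt2; rewrite /deg big1; first lia.
  by move=> i _; have := e0 i; case: (e i).
have [e_gt1|e_le1] := ltnP 1 (e i); first exact: reduce_ge2 e_gt1 de.
have [m mi em] := raise_pred e_gt0.
have {}mi : m i = 0%N by rewrite mi; lia.
have dm : (deg m + 3 = #|I|)%N by move: de; rewrite em deg_raise; lia.
have [|l nl ml] := @exists_zero I m i; first lia.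
(* Modulo [W], the term raised at [x] equals [F e] by [exchange] if [m x = 0]; otherwise it
   vanishes, its exponent at [x] being at least 2. *)
have Ws : W (\sum_(x | (x != l) && (x != i))
    (F (raise m x 1) - F e *+ (m x == 0%N))).
  apply: W_sum => x /andP[_ xi]; have [mx|mx] := eqVneq (m x) 0%N.
    by rewrite mulr1n em; apply: exchange => //; lia.
  rewrite subr0; apply: (@reduce_ge2 _ x); last by rewrite deg_raise; lia.
  by rewrite raise_eq; lia.
(* What is left is [F e] times a positive integer: 1 plus the number of zeros of [m] other than [i]
   and [l]. *)
have := WB (F_split1 ml dm) Ws; rewrite (bigD1 i) 1?eq_sym //= -em.
rewrite sumrB opprB addrA addrAC addrK sumrMnr -mulrS; exact: W_natmul.
Qed.

End Reduction.

(** * Words over an indexed family of letters, and their derivatives *)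

Section Words.
Variable k : fieldType.
Implicit Types (a b : DerPerm k) (s : seq dvar) (y : dvar).

Definition word s y : DerPerm k := foldr (fun x => pmul (gen k x)) (gen k y) s.

Lemma bmon_wordE (u : pmon) : bmon k u = word u.1 u.2.
Proof. by rewrite /word bmon_word seq_mset_id -surjective_pairing. Qed.

Lemma word_perm s t y : perm_eq s t -> word s y = word t y.
Proof.
move=> st; rewrite /word !bmon_word; congr (bmon _ (_, _)).
exact/eq_seq_msetP.
Qed.

Lemma pmul_word s y t z : pmul (word s y) (word t z) = word (s ++ y :: t) z.
Proof.
case: (DerPerm_perm k) => _ _ mA _.
by elim: s => //= x s IH; rewrite -mA IH.
Qed.

Lemma pmul_suml (J : Type) (r : seq J) (P : pred J) (G : J -> DerPerm k) b :
  pmul (\sum_(x <- r | P x) G x) b = \sum_(x <- r | P x) pmul (G x) b.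
Proof.
elim/big_rec2: _ => [|x u v _ <-]; first exact: pmul0l.
by rewrite -[G x]scale1r pmulPl !scale1r.
Qed.

Section Indexed.
Variables (I : finType) (c : I -> nat).
Implicit Types (e : {ffun I -> nat}) (r q : seq I) (i j o p : I).

(** Letters are named by positions in [I], so that equal letters stay apart and the derivation acts
    by raising the exponent at one position. *)
Definition iword e r o : DerPerm k :=
  word [seq (c j, e j) | j <- r] (c o, e o).

Lemma iword_perm e r q o : perm_eq r q -> iword e r o = iword e q o.
Proof. by move=> rq; apply/word_perm/perm_map. Qed.

Lemma eq_iword e e' r o : {in o :: r, e =1 e'} -> iword e r o = iword e' r o.
Proof.
move=> ee'; rewrite /iword ee' ?mem_head //; congr word.
by apply/eq_in_map => j jr; rewrite ee' // inE jr orbT.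
Qed.

Lemma pmul_iword e r o q p :
  pmul (iword e r o) (iword e q p) = iword e (r ++ o :: q) p.
Proof. by rewrite pmul_word /iword map_cat. Qed.

Lemma iword_cons e i r o n : e i = n ->
  iword e (i :: r) o = pmul (gen k (c i, n)) (iword e r o).
Proof. by move=> <-. Qed.

(** Each Leibniz term differentiates one letter; as no position is repeated, raising [e] there
    changes that letter only. *)
Lemma der_iword e r o : uniq (o :: r) ->
  der (iword e r o) = \sum_(j <- o :: r) iword (raise e j 1) r o.
Proof.
elim: r => [|x r IH].
  by rewrite big_seq1 /iword /word /= der_gen /succ_dvar raise_eq addn1.
rewrite /= inE negb_or -!andbA => /and4P[ox oNr xNr r_uniq].
rewrite /= oNr r_uniq in IH.
rewrite (iword_cons r o (erefl (e x))).
rewrite der_leibniz der_gen IH // linear_sum /= !big_cons /= addrCA.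
congr (_ + (_ + _)).
- by rewrite (@iword_cons _ x _ _ (e x)) ?raise_ne 1?eq_sym.
- rewrite (@iword_cons _ x _ _ (e x).+1) ?raise_eq ?addn1 //; congr pmul.
  apply: eq_iword => j; rewrite inE => /predU1P[->|jr].
    by rewrite raise_ne.
  by rewrite raise_ne //; apply: contraNneq xNr => <-.
- rewrite big_seq [RHS]big_seq; apply: eq_bigr => j jr.
  rewrite (@iword_cons _ x _ _ (e x)) ?raise_ne //.
  by apply: contraNneq xNr => ->.
Qed.

Lemma pmul_gen_der e r o i : e i = 0%N -> uniq (i :: o :: r) ->
  pmul (gen k (c i, 0%N)) (der (iword e r o)) =
  \sum_(j <- o :: r) iword (raise e j 1) (i :: r) o.
Proof.
move=> ei /andP[i_r or_uniq]; rewrite der_iword // linear_sum.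
rewrite big_seq [RHS]big_seq; apply: eq_bigr => j jr.
by rewrite (@iword_cons _ i _ _ 0%N) ?raise_ne //; apply: contraNneq i_r => ->.
Qed.

(** This order of the factors serves when [i] is the marked last position; [pmul_gen_der] serves
    when the marked position is another one. *)
Lemma pmul_der_gen e r o i : e i = 0%N -> uniq (i :: o :: r) ->
  pmul (der (iword e r o)) (gen k (c i, 0%N)) =
  \sum_(j <- o :: r) iword (raise e j 1) (o :: r) i.
Proof.
move=> ei /andP[i_r or_uniq]; rewrite der_iword // pmul_suml.
rewrite big_seq [RHS]big_seq; apply: eq_bigr => j jr.
have -> : gen k (c i, 0%N) = iword (raise e j 1) [::] i.
  by rewrite /iword /word /= raise_ne ?ei //; apply: contraNneq i_r => ->.
by rewrite pmul_iword; apply: iword_perm; rewrite cats1 perm_rcons.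
Qed.

Lemma pmul_der_der e r o q p : uniq ((o :: r) ++ p :: q) ->
  pmul (der (iword e r o)) (der (iword e q p)) =
  \sum_(i <- o :: r) \sum_(j <- p :: q)
     iword (raise (raise e i 1) j 1) (o :: r ++ q) p.
Proof.
rewrite cat_uniq => /and3P[or_uniq /hasPn disj pq_uniq].
rewrite !der_iword // pmul_suml big_seq [RHS]big_seq; apply: eq_bigr => i ir.
rewrite linear_sum big_seq [RHS]big_seq; apply: eq_bigr => j jq /=.
(* The two position lists are disjoint, so both words can be read off the single exponent function
   raised at [i] and at [j]. *)
have neq (x y : I) : x \in o :: r -> y \in p :: q -> x != y.
  by move=> xr yq; apply: contraNneq (disj _ yq) => <-.
rewrite (@eq_iword (raise e i 1) (raise (raise e i 1) j 1) r o); last first.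
  by move=> x xr; rewrite [RHS]raise_ne // neq.
rewrite (@eq_iword (raise e j 1) (raise (raise e i 1) j 1) q p); last first.
  by move=> x xq; rewrite raiseC [RHS]raise_ne // eq_sym neq.
rewrite pmul_iword; apply: iword_perm.
by rewrite perm_catC /= perm_cons perm_catC.
Qed.

End Indexed.
End Words.

(** * The two relations for words of weight -2 *)

Section Span.
Variable k : fieldType.
Implicit Types (a b : DerPerm k).

(** By the Leibniz rule this derivative is [bullet a b]; the relations below all come from here. *)
Lemma STbar_der_pmul a b : STbar a -> STbar b -> STbar (der (pmul a b)).
Proof. by move=> Sa Sb; rewrite der_leibniz; exact: STbar_bullet. Qed.

(* The equation on exponents says that [word s y] has weight [-2]. *)
Definition der_word_in_STbar_below (n : nat) := forall s y,
  (size s < n)%N -> (\sum_(x <- y :: s) x.2 + 2 = (size s).+1)%N ->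
  STbar (der (word k s y)).

Section Splitting.
Variables (I : finType) (c : I -> nat) (r : seq I) (o : I).
Hypothesis Ir : perm_eq (o :: r) (enum I).
Hypothesis shorter_words : der_word_in_STbar_below (size r).
Implicit Types (e : {ffun I -> nat}) (i j l : I) (t : seq I).

Let W a := STbar (der a).
Let F e := iword k c e r o.

Lemma perm_swapl (x y : I) t : perm_eq (x :: y :: t) (y :: x :: t).
Proof. by apply/permPl; exact: (perm_catCA [:: x] [:: y] t). Qed.

Lemma extend_enum t : uniq t -> exists q, perm_eq (t ++ q) (enum I).
Proof.
move=> t_uniq; exists [seq j <- enum I | j \notin t].
apply: uniq_perm => [||j].
- rewrite cat_uniq t_uniq filter_uniq ?enum_uniq // andbT.
  by apply/hasPn => j; rewrite mem_filter => /andP[].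
- exact: enum_uniq.
- by rewrite mem_cat mem_filter mem_enum andbT orbN.
Qed.

Lemma sum_neq1 (V : zmodType) (G : I -> V) i t : perm_eq (i :: t) (enum I) ->
  \sum_(j | j != i) G j = \sum_(j <- t) G j.
Proof.
move=> it; apply: (addrI (G i)).
transitivity (\sum_(j <- i :: t) G j); last by rewrite big_cons.
by rewrite (perm_big _ it) big_enum [RHS](bigD1 i).
Qed.

Lemma sum_neq2 (V : zmodType) (G : I -> V) i l t :
  perm_eq (i :: l :: t) (enum I) ->
  \sum_(j | (j != i) && (j != l)) G j = \sum_(j <- t) G j.
Proof.
move=> ilt; apply: (addrI (G l)).
have /= /andP[il _] : uniq (i :: l :: t) by rewrite (perm_uniq ilt) enum_uniq.
transitivity (\sum_(j <- l :: t) G j); last by rewrite big_cons.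
rewrite -(sum_neq1 G ilt) [RHS](bigD1 l) //.
by apply: contraNneq il => ->; rewrite mem_head.
Qed.

Lemma deg_perm e t : perm_eq t (enum I) -> deg e = (\sum_(j <- t) e j)%N.
Proof. by move=> tI; rewrite (perm_big _ tI) big_enum. Qed.

Lemma card_size : #|I| = (size r).+1.
Proof. by rewrite cardE -(perm_size Ir). Qed.

Lemma F_iword e t : perm_eq (o :: t) (enum I) -> F e = iword k c e t o.
Proof.
move=> ot; apply: iword_perm; rewrite -(perm_cons o).
by rewrite (perm_trans Ir) // perm_sym.
Qed.

Lemma size_perm t : perm_eq t (enum I) -> size t = (size r).+1.
Proof. by move=> tI; rewrite (perm_size tI) -cardE card_size. Qed.

Lemma W_shorter e p q : (size q < size r)%N ->
  (\sum_(j <- p :: q) e j + 2 = (size q).+1)%N -> W (iword k c e q p).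
Proof.
move=> ltq dq; apply: shorter_words; rewrite size_map //.
by rewrite -dq !big_cons big_map.
Qed.

(** The sum is the product of the letter at [i], a generator since [e i = 0], and the derivative of
    the word in the other positions, covered by [shorter_words]. *)
Lemma split1 e i : e i = 0%N -> (deg e + 3 = #|I|)%N ->
  W (\sum_(j | j != i) F (raise e j 1)).
Proof.
move=> ei de; have [t it] := @extend_enum [:: i] isT.
have it_uniq : uniq (i :: t) by rewrite (perm_uniq it) enum_uniq.
have st := size_perm it.
move: de; rewrite (deg_perm _ it) big_cons ei add0n card_size => de.
have Wt p q : perm_eq (p :: q) t -> W (iword k c e q p).
  move=> pq; have sq := perm_size pq.
  by apply: W_shorter; rewrite ?(perm_big _ pq); move: sq st de => /=; lia.
(* The letter at [o] must stay last: the generator goes on the right if [o = i], on the left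
   otherwise. *)
rewrite (sum_neq1 _ it); have [oi|oi] := eqVneq o i.
  case: t it it_uniq Wt st de => [|p q] it it_uniq Wt st de.
    by move: de; rewrite big_nil; move: st => /=; lia.
  have Fi e' : F e' = iword k c e' (p :: q) i.
    by rewrite (@F_iword _ (p :: q)) oi.
  under eq_bigr do rewrite Fi.
  rewrite -pmul_der_gen //; apply: STbar_der_pmul; first exact: Wt.
  exact: STbar_gen.
have ot : o \in t.
  by have := perm_mem it o; rewrite mem_enum inE (negbTE oi) => /= ->.
have oq := perm_to_rem ot; set q := rem o t in oq.
have ioq : perm_eq (i :: o :: q) (enum I).
  by apply: perm_trans it; rewrite perm_cons perm_sym.
rewrite (perm_big _ oq) /=.
have Fo e' : F e' = iword k c e' (i :: q) o.
  exact: F_iword (perm_trans (perm_swapl _ _ _) ioq).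
under eq_bigr do rewrite Fo.
rewrite -pmul_gen_der //; last by rewrite (perm_uniq ioq) enum_uniq.
apply: STbar_der_pmul; first exact: STbar_gen.
by apply: Wt; rewrite perm_sym.
Qed.

Lemma W_pair e i l : e i = 0%N -> e l = 0%N -> W (iword k c e [:: i] l).
Proof.
move=> ei el; rewrite /W /iword /word /= ei el.
by apply: STbar_der_pmul; exact: STbar_gen.
Qed.

(** The pair of letters at [i] and [o] contains the last one, so its derivative is taken as the
    right factor. *)
Lemma split2_last e i : i != o -> e i = 0%N -> e o = 0%N ->
  (deg e + 4 = #|I|)%N ->
  W (\sum_(j | (j != i) && (j != o))
       (F (raise (raise e i 1) j 1) + F (raise (raise e o 1) j 1))).
Proof.
move=> io ei eo de; have [|t ot] := @extend_enum [:: i; o].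
  by rewrite /= inE io.
have st := size_perm ot.
have I_uniq : uniq (i :: o :: t) by rewrite (perm_uniq ot) enum_uniq.
move: de; rewrite (deg_perm _ ot) !big_cons ei eo !add0n card_size => de.
rewrite (sum_neq2 _ ot).
case: t ot I_uniq st de => [|p q] ot I_uniq st de.
  by move: de; rewrite big_nil; move: st => /=; lia.
have -> : \sum_(j <- p :: q)
    (F (raise (raise e i 1) j 1) + F (raise (raise e o 1) j 1))
  = pmul (der (iword k c e q p)) (der (iword k c e [:: i] o)).
  rewrite pmul_der_der; last first.
    by rewrite uniq_catC (perm_uniq (perm_swapl _ _ _)).
  have opqi : perm_eq (o :: (p :: q) ++ [:: i]) (enum I).
    apply: perm_trans ot; apply/permPl.
    exact: (perm_catC (o :: p :: q) [:: i]).
  apply: eq_bigr => j _; rewrite big_cons big_seq1 addrC !(raiseC _ j).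
  by congr (_ + _); exact: F_iword.
apply: STbar_der_pmul; last exact: W_pair.
by apply: W_shorter; move: st de => /=; lia.
Qed.

(** By symmetry in [i] and [l], [split2_last] covers the pairs containing [o]. Otherwise the
    derivative of the pair is the left factor, and the remaining word, ending in [o], gives the
    right one. *)
Lemma split2 e i l : i != l -> e i = 0%N -> e l = 0%N ->
  (deg e + 4 = #|I|)%N ->
  W (\sum_(j | (j != i) && (j != l))
       (F (raise (raise e i 1) j 1) + F (raise (raise e l 1) j 1))).
Proof.
move=> il ei el de; have [lo|lo] := eqVneq l o.
  by rewrite lo in il el *; exact: split2_last.
have [io|io] := eqVneq i o.
  rewrite io in il ei *; under eq_bigl do rewrite andbC.
  under eq_bigr do rewrite addrC; exact: split2_last.
have [|q ilq] := @extend_enum [:: i; l; o].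
  by rewrite /= !inE negb_or il io lo.
have sq := size_perm ilq.
have I_uniq : uniq (i :: l :: o :: q) by rewrite (perm_uniq ilq) enum_uniq.
move: de; rewrite (deg_perm _ ilq) !big_cons ei el !add0n card_size => de.
rewrite (sum_neq2 _ ilq) big_split /=.
have -> : \sum_(j <- o :: q) F (raise (raise e i 1) j 1)
    + \sum_(j <- o :: q) F (raise (raise e l 1) j 1)
  = pmul (der (iword k c e [:: i] l)) (der (iword k c e q o)).
  have perm1 : perm_eq (o :: l :: i :: q) (i :: l :: o :: q).
    by apply/permP => a /=; lia.
  rewrite pmul_der_der; last first.
    by rewrite (perm_uniq (perm_swapl _ _ _)).
  rewrite [RHS]big_cons big_seq1 addrC.
  by congr (_ + _); apply: eq_bigr => j _; apply: F_iword;
    rewrite (perm_trans perm1).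
apply: STbar_der_pmul; first exact: W_pair.
by apply: W_shorter; rewrite ?big_cons; move: sq de => /=; lia.
Qed.

End Splitting.

(** * Induction on the length of the word *)

Lemma STbar_der_word :
  [pchar k] =i pred0 -> forall n, der_word_in_STbar_below n.
Proof.
move=> char0; elim=> [|n IH] s y //; rewrite ltnS => sn ds.
have {n IH sn} shorter : der_word_in_STbar_below (size s).
  by move=> t z ts; apply: IH; lia.
(* A single letter cannot have weight -2, and two letters of total weight -2 are both generators. *)
have [s_le1|s_gt1] := leqP (size s) 1%N.
  case: s {shorter} ds s_le1.
    by rewrite big_seq1 /=; lia.
  move=> [a i] [|//]; case: y => [b j]; rewrite !big_cons big_nil /= => ij _.
  have [-> ->] : i = 0%N /\ j = 0%N by lia.
  by apply: STbar_der_pmul; exact: STbar_gen.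
(* Position 0 carries the last letter [y], the other positions carry the letters of [s]. *)
pose I := 'I_(size s).+1; pose v (j : I) := nth y (y :: s) j.
pose c j := (v j).1; pose e : {ffun I -> nat} := [ffun j => (v j).2].
pose r := behead (enum I).
have Ir : perm_eq (ord0 :: r) (enum I) by rewrite /r enum_ordSl.
have sr : size r = size s by rewrite /r size_behead size_enum_ord.
have vE : [seq v j | j <- enum I] = y :: s.
  by rewrite -[RHS](mkseq_nth y) /mkseq -val_enum_ord -map_comp.
have rE : [seq v j | j <- r] = s by rewrite /r -behead_map vE.
have ve j : (c j, e j) = v j by rewrite ffunE -surjective_pairing.
have -> : word k s y = iword k c e r ord0.
  by rewrite /iword ve (eq_map ve) rE.
have I_card : #|I| = (size s).+1 by rewrite card_ord.
have de : (deg e + 2 = #|I|)%N.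
  apply: etrans (etrans ds (esym I_card)).
  rewrite -[in RHS]vE big_map big_enum /=; congr addn.
  by apply: eq_bigr => j _; rewrite ffunE.
apply: (@W_reduced _ _ (fun a => STbar (der a)) char0 _ _ _ I
   (fun e => iword k c e r ord0)) => //; last by rewrite I_card.
- by rewrite der0; exact: STbar_zero.
- by move=> a b Wa Wb; rewrite raddfD; exact: STbar_add.
- by move=> z a Wa; rewrite linearZ; exact: STbar_scale.
- by move=> m i; apply: split1; rewrite ?sr.
- by move=> m i l; apply: split2; rewrite ?sr.
Qed.

End Span.

Unset Implicit Arguments.
Set Strict Implicit.

Theorem theorem5p3 (k : fieldType) (char0 : [pchar k] =i pred0) :
  (forall u : pmon, wt u = -2 -> STbar (der (bmon k u)))
  /\ (forall v : DerPerm k, Sbar v -> STbar v).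
Proof.
have der_wt2 u : wt u = -2 -> STbar (der (bmon k u)).
  move=> wtu; rewrite bmon_wordE; apply: (STbar_der_word char0 (leqnn _)).
  (* Each letter contributes its exponent minus 1, so weight -2 becomes the equation required by
     [der_word_in_STbar_below]. *)
  have wtE : wt u = (\sum_(x <- u.2 :: u.1) x.2)%N%:Z - (size u.1).+1%:Z.
    rewrite /wt big_cons; elim: (EnumMset.f u.1) => [|x s IH] /=.
      by rewrite !big_nil; lia.
    rewrite !big_cons -addrA IH /=; lia.
  by move: wtE; rewrite wtu; move: (bigop.body _ _ _) (size _) => d n; lia.
split=> // v [[j ->]|[u [wtu ->]]]; first exact: STbar_gen.
exact: der_wt2.
Qed.
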